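(* Let $d\in\{1,2\}$. Consider the limited cell average update $$\overline U_i^{\mathrm{pp}}=\overline U_i-\sum_{\ell=1}^d r_\ell\left(\widehat F^{\mathrm{pp}}_{i+\frac12e_\ell}-\widehat F^{\mathrm{pp}}_{i-\frac12e_\ell}\right),\qquad \widehat F^{\mathrm{pp}}_{i+\frac12e_\ell}=\widehat F^L_{i+\frac12e_\ell}+\theta^{\mathrm{pp}}_{i+\frac12e_\ell}\left(\widehat F^{s}_{i+\frac12e_\ell}-\widehat F^L_{i+\frac12e_\ell}\right),$$ where $r_\ell=\Delta t/\Delta x_\ell$ and $\theta^{\mathrm{pp}}_{i+\frac12e_\ell}\in[0,1]$, and the limited intermediate states $$U^{\mathrm{pp},+}_{\ell,i}=U^{L,+}_{\ell,i}-2d\,r_\ell\,\theta^{\mathrm{pp}}_{i+\frac12e_\ell}\left(\widehat F^s_{i+\frac12e_\ell}-\widehat F^L_{i+\frac12e_\ell}\right),\qquad U^{\mathrm{pp},-}_{\ell,i}=U^{L,-}_{\ell,i}+2d\,r_\ell\,\theta^{\mathrm{pp}}_{i-\frac12e_\ell}\left(\widehat F^s_{i-\frac12e_\ell}-\widehat F^L_{i-\frac12e_\ell}\right).$$ (1) If $U^{\mathrm{pp},\pm}_{\ell,i}\in\mathcal G$ for all $i$ and all $\ell=1,\dots,d$, then the limited cell average update is positivity-preserving, i.e. $\overline U_i^{\mathrm{pp}}\in\mathcal G$ for all $i$, under the CFL condition $$\Delta t\leqslant\min_{1\leqslant\ell\leqslant d}\frac{\Delta x_\ell}{2d\max_i\{\lambda_{i+\frac12e_\ell}\}}.$$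 (2) If this limiting is applied in every forward-Euler stage of a strong-stability-preserving (SSP) Runge--Kutta method (each stage of which is a convex combination of forward-Euler steps, here the limited updates with their limited intermediate states in $\mathcal G$ and step size $\Delta t$ satisfying $\Delta t\leqslant\min_{1\leqslant\ell\leqslant d}\frac{\Delta x_\ell}{2d\max_i\{\lambda_{i+\frac12e_\ell}\}}$, where $\Delta t$ is the step size of the forward-Euler step in question and the $\lambda_{i+\frac12e_\ell}$ are evaluated from the cell averages at the beginning of that forward-Euler step), then the SSP Runge--Kutta method preserves the positivity-preserving property, i.e. its cell averages remain in $\mathcal G$.
   Context: **States.** $U=(\rho,\rho\mathbf u,E)^\top\in\mathbb R^{d+2}$ with $\mathbf u=(u_1,\dots,u_d)$, $E=\rho e+\frac12\rho\|\mathbf u\|^2$, $p=(\gamma-1)\rho e$, $\gamma>1$, $T=p/\rho$, $c=\sqrt{\gamma p/\rho}$, $\varrho_\ell(U)=|u_\ell|+c$. The admissible set is $\mathcal G=\{U:\rho>0,\ p=(\gamma-1)(E-\frac{\|\rho\mathbf u\|^2}{2\rho})>0\}$. $e_\ell$ denotes the $\ell$-th unit vector. The cell averages $\overline U_i$ at the beginning of the step are assumed to lie in $\mathcal G$. **Fluxes.** $F^c_\ell(U)=(\rho u_\ell,\ \rho\mathbf u u_\ell+p\,e_\ell,\ (E+p)u_\ell)^\top$. Let $Z=(0,\mathbf u,T)^\top$ and let $S$ denote an approximation of $\nabla Z$, containing $G\in\mathbb R^{d\times d}$ approximating $\nabla\mathbf u$ and $g\in\mathbb R^d$ approximating $\nabla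 T$. Form $\tau=\mu(G+G^\top-\frac23(\mathrm{tr}\,G)I_d)$, $q=-\kappa g$ ($\mu>0$, $\kappa=\frac{\gamma\mu}{(\gamma-1)\Pr}$, $\Pr>0$ constants), $\tau_\ell=\tau e_\ell$, $q_\ell=q\cdot e_\ell$, $F^v_\ell(U,S)=(0,\tau_\ell,\mathbf u\cdot\tau_\ell-q_\ell)^\top$, $$b_\ell(U,S)=\frac{\sqrt{\rho^2q_\ell^2+2\rho^2e\|\tau_\ell\|^2}+\rho|q_\ell|}{2\rho^2e}.$$ **Low-order quantities.** On a uniform Cartesian mesh with cell sizes $\Delta x_\ell$ and cells indexed by $i\in\mathbb Z^d$ (finite meshes being extended e.g. periodically), $S_i$ is the central difference of $Z(\overline U_i)$, $F_{\ell,i}=F^c_\ell(\overline U_i)-F^v_\ell(\overline U_i,S_i)$, $$\widehat F^L_{i+\frac12e_\ell}=\tfrac12(F_{\ell,i}+F_{\ell,i+e_\ell})-\tfrac{\lambda_{i+\frac12e_\ell}}2(\overline U_{i+e_\ell}-\overline U_i),\quad\lambda_{i+\frac12e_\ell}=\alpha_{i+\frac12e_\ell}+\beta_{i+\frac12e_\ell},$$ $\alpha_{i+\frac12e_\ell}=\max\{\varrho_\ell(\overline U_i),\varrho_\ell(\overline U_{i+e_\ell})\}$, $\beta_{i+\frac12e_\ell}=\max\{b_\ell(\overline U_i,S_i),b_\ell(\overline U_{i+e_\ell},S_{i+e_\ell})\}$, and $U^{L,+}_{\ell,i}=\overline U_i-2d\,r_\ell(\widehat F^L_{i+\frac12e_\ell}-F_{\ell,i})$,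 $U^{L,-}_{\ell,i}=\overline U_i-2d\,r_\ell(F_{\ell,i}-\widehat F^L_{i-\frac12e_\ell})$. **High-order quantities.** $\widehat F^s_{i+\frac12e_\ell}=\widehat F^L_{i+\frac12e_\ell}+\theta^s_{i+\frac12e_\ell}(\widehat F^H_{i+\frac12e_\ell}-\widehat F^L_{i+\frac12e_\ell})$, where $\widehat F^H_{i+\frac12e_\ell}\in\mathbb R^{d+2}$ is the given high-order numerical flux (inviscid minus viscous) of the active flux method at the interface and $\theta^s_{i+\frac12e_\ell}\in[0,1]$ is a given smoothness-based blending coefficient; both are treated as given data. *)

(* Defs.v *)
From HB Require Import structures.
From mathcomp Require Import all_boot all_order all_algebra.
From mathcomp Require Import all_classical all_reals ereal.

Set Implicit Arguments.
Unset Strict Implicit.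
Unset Printing Implicit Defensive.

Import Order.TTheory GRing.Theory Num.Theory.

Local Open Scope ring_scope.

(* Euclidean: the library's norm on matrices is the max-norm. *)
Definition dotv (R : realType) (d : nat) (v w : 'cV[R]_d) : R :=
  \sum_j v j 0 * w j 0.

Definition sqnorm (R : realType) (d : nat) (v : 'cV[R]_d) : R := dotv v v.

(* Vectors of R^(d+2), in blocks of sizes 1, d, 1. *)
Definition state (R : realType) (d : nat) := 'cV[R]_(1 + (d + 1)).

Definition mkstate (R : realType) (d : nat) (a : R) (v : 'cV[R]_d) (b : R) :
  state R d := col_mx a%:M (col_mx v b%:M).

Section States.
Variables (R : realType) (d : nat).
Variable gamma : R.
Implicit Types U : state R d.

Definition density U : R := usubmx U 0 0.
Definition momentum U : 'cV[R]_d := usubmx (dsubmx U).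
Definition energy U : R := dsubmx (dsubmx U) 0 0.

Definition velocity U : 'cV[R]_d := (density U)^-1 *: momentum U.

(* Solves E = rho e + rho |u|^2 / 2 for e. *)
Definition internal_energy U : R :=
  (energy U - 2^-1 * density U * sqnorm (velocity U)) / density U.

(* Equal to (gamma - 1) rho e when rho != 0. *)
Definition pressure U : R :=
  (gamma - 1) * (energy U - sqnorm (momentum U) / (2 * density U)).

Definition temperature U : R := pressure U / density U.

Definition sound_speed U : R := Num.sqrt (gamma * pressure U / density U).

Definition spectral_radius (l : 'I_d) U : R :=
  `|velocity U l 0| + sound_speed U.

Definition admissible : set (state R d) :=
  [set U | 0 < density U /\ 0 < pressure U].

End States.

Section Fluxes.
Variables (R : realType) (d : nat).
Variables gamma mu Pr : R.
Implicit Types (U : state R d) (S : 'M[R]_(1 + (d + 1), d)) (l : 'I_d).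

Definition convective_flux l U : state R d :=
  mkstate (density U * velocity U l 0)
          (velocity U l 0 *: (density U *: velocity U)
             + pressure gamma U *: delta_mx l 0)
          ((energy U + pressure gamma U) * velocity U l 0).

Definition Zvars U : state R d := mkstate 0 (velocity U) (temperature gamma U).

(* Column l of S approximates the partial derivative of Z in direction l. *)
Definition grad_velocity S : 'M[R]_d := usubmx (dsubmx S).
Definition grad_temperature S : 'cV[R]_d := (dsubmx (dsubmx S))^T.

Definition stress S : 'M[R]_d :=
  let G := grad_velocity S in mu *: (G + G^T - (2 / 3 * \tr G)%:M).

Definition conductivity : R := gamma * mu / ((gamma - 1) * Pr).

Definition heat_flux S : 'cV[R]_d := - conductivity *: grad_temperature S.

Definition viscous_flux l U S : state R d :=
  mkstate 0 (col l (stress S))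
          (dotv (velocity U) (col l (stress S)) - heat_flux S l 0).

Definition viscous_speed l U S : R :=
  let rho := density U in let e := internal_energy U in
  let tau := col l (stress S) in let q := heat_flux S l 0 in
  (Num.sqrt (rho ^+ 2 * q ^+ 2 + 2 * rho ^+ 2 * e * sqnorm tau) + rho * `|q|)
    / (2 * rho ^+ 2 * e).

End Fluxes.

(* Cells are indexed by Z^d. The interface i + e_l / 2 is the pair (l, i), so
   that i - e_l / 2 is the pair (l, i - e_l). *)
Definition cell (d : nat) := 'rV[int]_d.

Definition unitv (d : nat) (l : 'I_d) : cell d := delta_mx 0 l.

Section Scheme.
Variables (R : realType) (d : nat).
Variables gamma mu Pr : R.
Variable dx : 'I_d -> R.
Implicit Types (U : cell d -> state R d) (i : cell d) (l : 'I_d) (dt : R).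

Definition central_gradient U i : 'M[R]_(1 + (d + 1), d) :=
  \matrix_(k, l) ((Zvars gamma (U (i + unitv l)) k 0
                   - Zvars gamma (U (i - unitv l)) k 0) / (2 * dx l)).

Definition cell_flux U l i : state R d :=
  convective_flux gamma l (U i)
  - viscous_flux gamma mu Pr l (U i) (central_gradient U i).

Definition alpha_speed U l i : R :=
  Num.max (spectral_radius gamma l (U i))
          (spectral_radius gamma l (U (i + unitv l))).

Definition beta_speed U l i : R :=
  Num.max
    (viscous_speed gamma mu Pr l (U i) (central_gradient U i))
    (viscous_speed gamma mu Pr l (U (i + unitv l))
                   (central_gradient U (i + unitv l))).

Definition lambda_speed U l i : R := alpha_speed U l i + beta_speed U l i.

Definition low_flux U l i : state R d :=
  2^-1 *: (cell_flux U l i + cell_flux U l (i + unitv l))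
  - (lambda_speed U l i / 2) *: (U (i + unitv l) - U i).

Definition low_state_plus dt U l i : state R d :=
  U i - ((2 * d)%:R * (dt / dx l)) *: (low_flux U l i - cell_flux U l i).

Definition low_state_minus dt U l i : state R d :=
  U i - ((2 * d)%:R * (dt / dx l)) *:
          (cell_flux U l i - low_flux U l (i - unitv l)).

(* The given data of one forward-Euler step. *)
Record step_data := StepData {
  high_flux : 'I_d -> cell d -> state R d;
  theta_s : 'I_d -> cell d -> R;
  theta_pp : 'I_d -> cell d -> R }.

Implicit Types D : step_data.

Definition blending_coefficients D : Prop :=
  forall l i, 0 <= theta_s D l i <= 1 /\ 0 <= theta_pp D l i <= 1.

Definition s_flux U D l i : state R d :=
  low_flux U l i + theta_s D l i *: (high_flux D l i - low_flux U l i).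

Definition pp_flux U D l i : state R d :=
  low_flux U l i + theta_pp D l i *: (s_flux U D l i - low_flux U l i).

Definition pp_update dt U D i : state R d :=
  U i - \sum_(l < d) (dt / dx l) *: (pp_flux U D l i
                                     - pp_flux U D l (i - unitv l)).

Definition pp_state_plus dt U D l i : state R d :=
  low_state_plus dt U l i
  - ((2 * d)%:R * (dt / dx l) * theta_pp D l i) *:
      (s_flux U D l i - low_flux U l i).

Definition pp_state_minus dt U D l i : state R d :=
  low_state_minus dt U l i
  + ((2 * d)%:R * (dt / dx l) * theta_pp D l (i - unitv l)) *:
      (s_flux U D l (i - unitv l) - low_flux U l (i - unitv l)).

Definition limited_states_admissible dt U D : Prop :=
  forall i l, admissible gamma (pp_state_plus dt U D l i)
           /\ admissible gamma (pp_state_minus dt U D l i).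

(* The maximum over the infinite index set is the supremum in \bar R, where
   x / +oo = 0: the condition then excludes dt > 0 if the speeds are unbounded.
   For finite (periodically extended) meshes it is the ordinary maximum. *)
Definition CFL dt U : Prop :=
  (dt%:E <= \big[Order.min/+oo]_(l < d)
     ((dx l)%:E /
      ((2 * d)%:R%:E * ereal_sup (range (fun i => (lambda_speed U l i)%:E)))))%E.

(* Shu-Osher form with s stages: stage k + 1 is the convex combination, with
   weights a k m (m <= k), of forward-Euler steps from the stages m with step
   sizes (b k m / a k m) * dt. *)
Definition ssp_coefficients (s : nat) (a b : nat -> nat -> R) : Prop :=
  (0 < s)%N /\
  forall k, (k < s)%N ->
    \sum_(m < k.+1) a k m = 1 /\
    forall m, (m <= k)%N ->
      [/\ 0 <= a k m, 0 <= b k m & a k m = 0 -> b k m = 0].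

(* Each stage needs its own data for each forward-Euler step in it, since the
   limiting depends on the step size; a term with b k m = 0 is just
   a k m *: W m, with no forward-Euler step to limit. *)
Definition ssp_rk_step (s : nat) (a b : nat -> nat -> R) dt
    (D : nat -> nat -> step_data) (W : nat -> cell d -> state R d)
    (Uold Unew : cell d -> state R d) : Prop :=
  [/\ forall i, W 0%N i = Uold i,
      forall k i, (k < s)%N ->
        W k.+1 i = \sum_(m < k.+1)
          a k m *: pp_update (b k m / a k m * dt) (W m) (D k m) i
    & forall i, Unew i = W s i].

Definition ssp_rk_limited (s : nat) (a b : nat -> nat -> R) dt
    (D : nat -> nat -> step_data) (W : nat -> cell d -> state R d) : Prop :=
  forall k m, (k < s)%N -> (m <= k)%N -> 0 < b k m ->
    [/\ blending_coefficients (D k m),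
        limited_states_admissible (b k m / a k m * dt) (W m) (D k m)
      & CFL (b k m / a k m * dt) (W m)].

End Scheme.

(* Main.v *)
Require Import Defs.
From HB Require Import structures.
From mathcomp Require Import all_boot all_order all_algebra.
From mathcomp Require Import all_classical all_reals ereal.
From mathcomp Require Import ring lra.

Set Implicit Arguments.
Unset Strict Implicit.
Unset Printing Implicit Defensive.

Import Order.TTheory GRing.Theory Num.Theory.

Local Open Scope ring_scope.

(** The admissible set is a convex cone without apex: scaling a state scales
    its density and pressure, and the pressure is superadditive because
    the kinetic energy |m|^2 / (2 rho) is a perspective function, hence
    subadditive ([pressureD_ge]). So any conic combination of admissible states
    with a positive total weight is admissible ([admissible_conic]).

    For one limited step, substituting the blended flux into the intermediate
    states gives U -/+ 2 d r_l (F^pp - F_l), where F_l is the flux of the cell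
    itself. In the sum of the two states of a direction F_l cancels, and the
    limited update is the average of the 2 d intermediate states of the cell
    ([pp_update_average]).

    A Runge-Kutta stage is a convex combination of such steps, in which a term
    with a vanishing step size is the earlier stage itself; induction on
    the stages and then on the time steps concludes
    ([ssp_stage_admissible]). *)

Section AdmissibleCone.
Variables (R : realType) (d : nat).
Implicit Types U V : state R d.

Lemma densityD U V : density (U + V) = density U + density V.
Proof. by rewrite /density !mxE. Qed.

Lemma densityZ (c : R) U : density (c *: U) = c * density U.
Proof. by rewrite /density !mxE. Qed.

(** Joint convexity and homogeneity of x ^ 2 / a: the gap between the two sides
    is (b x - a y) ^ 2 / (a b (a + b)). *)
Lemma sqr_div_subadditive (x y a b : R) : 0 < a -> 0 < b ->
  (x + y) ^+ 2 / (a + b) <= x ^+ 2 / a + y ^+ 2 / b.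
Proof.
move=> a0 b0; have ab0 : 0 < a + b by rewrite addr_gt0.
rewrite -subr_ge0.
have -> : x ^+ 2 / a + y ^+ 2 / b - (x + y) ^+ 2 / (a + b)
    = (b * x - a * y) ^+ 2 / (a * b * (a + b)).
  by field; rewrite !gt_eqF.
by rewrite divr_ge0 ?sqr_ge0 // !mulr_ge0 // ltW.
Qed.

Lemma sqnorm_div_subadditive (v w : 'cV[R]_d) (a b : R) : 0 < a -> 0 < b ->
  sqnorm (v + w) / (a + b) <= sqnorm v / a + sqnorm w / b.
Proof.
move=> a0 b0; rewrite /sqnorm /dotv !mulr_suml -big_split /=.
by apply: ler_sum => j _; rewrite mxE -!expr2 sqr_div_subadditive.
Qed.

Variable gamma : R.

Lemma pressureZ (c : R) U : c != 0 ->
  pressure gamma (c *: U) = c * pressure gamma U.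
Proof.
move=> c0; rewrite /pressure densityZ.
have -> : energy (c *: U) = c * energy U by rewrite /energy !mxE.
have -> : sqnorm (momentum (c *: U)) = c ^+ 2 * sqnorm (momentum U).
  rewrite /sqnorm /dotv mulr_sumr; apply: eq_bigr => j _.
  by rewrite /momentum !mxE; ring.
have -> : c ^+ 2 * sqnorm (momentum U) / (2 * (c * density U))
    = c * (sqnorm (momentum U) / (2 * density U)).
  by rewrite [2 * (c * _)]mulrCA -mulf_div expr2 mulfK.
by ring.
Qed.

Hypothesis gamma1 : 1 < gamma.

Lemma pressureD_ge U V : 0 < density U -> 0 < density V ->
  pressure gamma U + pressure gamma V <= pressure gamma (U + V).
Proof.
move=> dU dV; rewrite /pressure -mulrDr ler_pM2l ?subr_gt0 // densityD.
have -> : energy (U + V) = energy U + energy V by rewrite /energy !mxE.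
have -> : momentum (U + V) = momentum U + momentum V.
  by rewrite /momentum !linearD.
have := @sqnorm_div_subadditive (momentum U) (momentum V) _ _
  (mulr_gt0 (ltr0n R 2) dU) (mulr_gt0 (ltr0n R 2) dV).
by rewrite -mulrDr; lra.
Qed.

Lemma admissibleD U V :
  admissible gamma U -> admissible gamma V -> admissible gamma (U + V).
Proof.
move=> [dU pU] [dV pV]; split; first by rewrite densityD addr_gt0.
by apply: lt_le_trans (pressureD_ge dU dV); rewrite addr_gt0.
Qed.

Lemma admissibleZ (c : R) U :
  0 < c -> admissible gamma U -> admissible gamma (c *: U).
Proof.
move=> c0 [dU pU]; split; first by rewrite densityZ mulr_gt0.
by rewrite pressureZ ?gt_eqF // mulr_gt0.
Qed.

(** The cone does not contain 0, hence the hypothesis that not all weights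
    vanish. *)
Lemma admissible_conic (I : finType) (w : I -> R) (V : I -> state R d) :
  (forall i, 0 <= w i) -> 0 < \sum_i w i ->
  (forall i, admissible gamma (V i)) ->
  admissible gamma (\sum_i w i *: V i).
Proof.
move=> w0 wsum Vadm.
have [i0 wi0] : exists i, 0 < w i.
  apply: contrapT => /forallNP nw; move: wsum; rewrite big1 ?ltxx // => i _.
  by apply/eqP; rewrite eq_le w0 andbT leNgt; apply/negP/nw.
rewrite (bigD1 i0) //=.
(* Terms are added one by one to the term of index i0, which keeps the partial
   sums in the cone. *)
apply: (big_rec (fun x => admissible gamma (w i0 *: V i0 + x))).
  by rewrite addr0; apply: admissibleZ.
move=> i x _ adm; rewrite addrCA.
have [->|wi] := eqVneq (w i) 0; first by rewrite scale0r add0r.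
have wi_gt0 : 0 < w i by rewrite lt_def wi w0.
by apply: admissibleD => //; apply: admissibleZ.
Qed.

End AdmissibleCone.

Section LimitedStep.
Variables (R : realType) (d : nat) (gamma mu Pr : R) (dx : 'I_d -> R).
Implicit Types (U : cell d -> state R d) (D : step_data R d).

Local Notation update := (pp_update gamma mu Pr dx).
Local Notation state_plus := (pp_state_plus gamma mu Pr dx).
Local Notation state_minus := (pp_state_minus gamma mu Pr dx).

(** The flux of the cell enters the two states of a direction with opposite
    signs; what remains of their sum is the flux difference of the update. *)
Lemma pp_update_average dt U D i : (0 < d)%N ->
  update dt U D i
  = \sum_(l < d) (2 * d)%:R^-1 *: (state_plus dt U D l i
                                   + state_minus dt U D l i).
Proof.
move=> d0; have dR : d%:R != 0 :> R by rewrite pnatr_eq0 -lt0n.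
have -> : update dt U D i
    = \sum_(l < d) (d%:R^-1 *: U i
        - (dt / dx l) *: (pp_flux gamma mu Pr dx U D l i
                          - pp_flux gamma mu Pr dx U D l (i - unitv l))).
  rewrite big_split /= sumrN sumr_const card_ord -scaler_nat scalerA.
  by rewrite divff // scale1r.
apply: eq_bigr => l _.
rewrite /pp_state_plus /pp_state_minus /low_state_plus /low_state_minus /pp_flux.
move: (s_flux _ _ _ _ _ _ _ i) (s_flux _ _ _ _ _ _ _ (i - _)) => S S'.
move: (low_flux _ _ _ _ _ _ i) (low_flux _ _ _ _ _ _ (i - _)) => L L'.
move: (cell_flux _ _ _ _ _ _ _) => F; move: (dt / dx l) => r.
apply/matrixP => j k; rewrite !mxE natrM.
by field.
Qed.

Lemma pp_update_dt0 U D i : update 0 U D i = U i.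
Proof. by rewrite /pp_update big1 ?subr0 // => l _; rewrite mul0r scale0r. Qed.

Hypothesis gamma1 : 1 < gamma.

Lemma pp_update_admissible dt U D : (0 < d)%N ->
  limited_states_admissible gamma mu Pr dx dt U D ->
  forall i, admissible gamma (update dt U D i).
Proof.
move=> d0 lim i; rewrite pp_update_average //.
have w0 : 0 < (2 * d)%:R^-1 :> R by rewrite invr_gt0 ltr0n muln_gt0.
apply: admissible_conic => // [|l].
  by rewrite sumr_const card_ord pmulrn_lgt0.
by case: (lim i l) => Hp Hm; apply: admissibleD.
Qed.

Lemma ssp_stage_admissible (s : nat) (a b : nat -> nat -> R) dt
    (D : nat -> nat -> step_data R d) (W : nat -> cell d -> state R d)
    (Uold Unew : cell d -> state R d) :
  (0 < d)%N -> ssp_coefficients s a b ->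
  ssp_rk_step gamma mu Pr dx s a b dt D W Uold Unew ->
  ssp_rk_limited gamma mu Pr dx s a b dt D W ->
  (forall i, admissible gamma (Uold i)) ->
  forall k i, (k <= s)%N -> admissible gamma (W k i).
Proof.
move=> d0 [_ coef] [W0 WS _] lim Uadm k.
elim/ltn_ind: k => -[|k] IH i ks; first by rewrite W0.
have [asum ab] := coef k ks.
rewrite WS //; apply: admissible_conic => // [m||m].
- by have [] := ab m (ltn_ord m).
- by rewrite asum.
have [_ + _] := ab m (ltn_ord m).
rewrite le_eqVlt => /predU1P[<-|bm].
  rewrite mul0r mul0r pp_update_dt0.
  by apply: IH => //; apply: ltnW (leq_trans _ ks).
by apply: pp_update_admissible => //; have [] := lim k m ks (ltn_ord m) bm.
Qed.

End LimitedStep.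

Theorem proposition3p2 (R : realType) (d : nat) (hd : d = 1%N \/ d = 2%N)
    (gamma mu Pr : R) (hgamma : 1 < gamma) (hmu : 0 < mu) (hPr : 0 < Pr)
    (dx : 'I_d -> R) (hdx : forall l, 0 < dx l) :
  (forall (dt : R) (U : cell d -> state R d) (D : step_data R d),
     0 < dt ->
     (forall i, admissible gamma (U i)) ->
     blending_coefficients D ->
     limited_states_admissible gamma mu Pr dx dt U D ->
     CFL gamma mu Pr dx dt U ->
     forall i, admissible gamma (pp_update gamma mu Pr dx dt U D i))
  /\
  (forall (s : nat) (a b : nat -> nat -> R), ssp_coefficients s a b ->
   forall (N : nat) (dt : nat -> R) (U : nat -> cell d -> state R d)
     (W : nat -> nat -> cell d -> state R d)
     (D : nat -> nat -> nat -> step_data R d),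
     (forall i, admissible gamma (U 0%N i)) ->
     (forall n, (n < N)%N ->
        [/\ 0 < dt n,
            ssp_rk_step gamma mu Pr dx s a b (dt n) (D n) (W n) (U n) (U n.+1)
          & ssp_rk_limited gamma mu Pr dx s a b (dt n) (D n) (W n)]) ->
     (forall n i, (n <= N)%N -> admissible gamma (U n i)) /\
     (forall n k i, (n < N)%N -> (k <= s)%N -> admissible gamma (W n k i))).
Proof.
have d0 : (0 < d)%N by case: hd => ->.
split=> [dt U D _ _ _ lim _ i|s a b ab N dt U W D U0 steps].
  exact: pp_update_admissible.
have stages n : (n < N)%N -> (forall i, admissible gamma (U n i)) ->
    forall k i, (k <= s)%N -> admissible gamma (W n k i).
  move=> nN Un; have [_ step lim] := steps n nN.
  exact: ssp_stage_admissible step lim Un.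
have Uadm n i : (n <= N)%N -> admissible gamma (U n i).
  elim: n i => [|n IH] i nN //.
  have [_ [_ _ ->] _] := steps n nN.
  by apply: stages => // j; apply/IH/ltnW.
by split=> // n k i nN ks; apply: stages => // j; apply/Uadm/ltnW.
Qed.
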